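(* Let $A\in\mathbb{R}^{2n\times 2n}$. The following conditions are equivalent: (a) $A\in\mathrm{GH}(2n)$, i.e. $A$ is diagonalizable (over $\mathbb{C}$) and all its eigenvalues are nonzero and purely imaginary. (b) $A$ is a generalized Hamiltonian matrix and the system $\dot x=Ax$ is marginally stable. (c) There exists an invertible $G\in\mathbb{R}^{2n\times 2n}$ such that $G^{-1}AG=J_{2n}L_0$, where $L_0=\mathrm{diag}(\beta,\beta)$, $\beta=\mathrm{diag}(\beta_1,\ldots,\beta_n)$, and $\beta_1\ge\cdots\ge\beta_n>0$. Further, with $G$ and $L_0$ as in (c), one has $A=JL$ with $J=GJ_{2n}G^{\tau}$ and $L=G^{-\tau}L_0G^{-1}$, where $J\in\mathrm{SS}(2n)$ and $L\in\mathrm{SPD}(2n)$.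
   Context: $\mathrm{SPD}(m)$ is the set of real symmetric positive-definite $m\times m$ matrices; $\mathrm{SS}(m)$ is the set of real nonsingular skew-symmetric $m\times m$ matrices; $\tau$ denotes transpose and $G^{-\tau}=(G^{-1})^{\tau}$. $J_{2n}=\begin{bmatrix}0&I_n\\-I_n&0\end{bmatrix}$. A generalized Hamiltonian matrix is a matrix of the form $A=JL$ with $J\in\mathrm{SS}(2n)$ and $L\in\mathbb{R}^{2n\times 2n}$ symmetric and nonsingular. The system $\dot x=Ax$ is marginally stable if for every initial condition $x(0)=x_0$ the solution $x(t)$ is uniformly bounded for $t\ge0$ (equivalently, all eigenvalues of $A$ have non-positive real part and all Jordan blocks of eigenvalues with zero real part are $1\times1$). *)

(* Defs.v *)
From HB Require Import structures.
From mathcomp Require Import all_boot all_order all_algebra.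
From mathcomp Require Import sesquilinear.
From mathcomp Require Import all_classical all_reals all_analysis.
From mathcomp Require Import complex.

Set Implicit Arguments.
Unset Strict Implicit.
Unset Printing Implicit Defensive.

Import Order.TTheory GRing.Theory Num.Theory.
Import numFieldNormedType.Exports.

Local Open Scope classical_set_scope.
Local Open Scope ring_scope.

Definition SPD (R : realType) (m : nat) (L : 'M[R]_m) : Prop :=
  L \is symmetricmx /\
  forall x : 'cV[R]_m, x != 0 -> 0 < (x^T *m L *m x) 0 0.

Definition SS (R : realType) (m : nat) (J : 'M[R]_m) : Prop :=
  J \is skewmx /\ J \in unitmx.

Definition symplectic_unit (R : realType) (n : nat) : 'M[R]_(n + n) :=
  block_mx 0 1%:M (- 1%:M) 0.

Definition complexify (R : realType) (m : nat) (A : 'M[R]_m) : 'M[R[i]]_m :=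
  map_mx (real_complex R) A.

Definition GH (R : realType) (m : nat) (A : 'M[R]_m) : Prop :=
  diagonalizable (complexify A) /\
  forall l : R[i], eigenvalue (complexify A) l ->
    l != 0 /\ complex.Re l = 0.

Definition generalized_hamiltonian (R : realType) (m : nat) (A : 'M[R]_m) :
    Prop :=
  exists J L : 'M[R]_m,
    [/\ SS J, L \is symmetricmx, L \in unitmx & A = J *m L].

(* A solution on [0, +oo[ is extended arbitrarily to negative times; only
   continuity from the right is required at the initial time, which for a
   linear system forces the one-sided derivative there as well. *)
Definition solves (R : realType) (m : nat) (A : 'M[R]_m) (x0 : 'cV[R]_m)
    (x : R -> 'cV[R]_m) : Prop :=
  [/\ x 0 = x0,
      {within `[0, +oo[, continuous x} &
      forall t : R, 0 < t -> is_derive t 1 x (A *m x t)].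

Definition marginally_stable (R : realType) (m : nat) (A : 'M[R]_m) : Prop :=
  forall (x0 : 'cV[R]_m) (x : R -> 'cV[R]_m), solves A x0 x ->
    exists M : R, forall t : R, 0 <= t -> `|x t| <= M.

Definition diag2 (R : realType) (n : nat) (b : 'rV[R]_n) : 'M[R]_(n + n) :=
  block_mx (diag_mx b) 0 0 (diag_mx b).

Definition reduces_by (R : realType) (n : nat) (A G : 'M[R]_(n + n))
    (b : 'rV[R]_n) : Prop :=
  [/\ G \in unitmx,
      forall i j : 'I_n, (i <= j)%N -> b 0 j <= b 0 i,
      forall i : 'I_n, 0 < b 0 i &
      invmx G *m A *m G = symplectic_unit R n *m diag2 b].

(* Main.v *)
(* A real matrix A satisfying (a) is built up from planes
   spanned by real and imaginary parts x, y of left eigenvectors, on which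
   x A = - beta y and y A = beta x: as long as these planes do not fill the
   space, diagonalizability gives a complex eigenvector outside their span, and
   since the span is invariant, the new plane meets it trivially.  This gives the
   normal form J_{2n} L_0, hence A = J L with L positive definite, and then
   x^T L x is conserved along solutions, so these are bounded.  Conversely, if
   A = J L is stable, the explicit solutions Re (e^{l t} (w + t v)) rule out
   eigenvalues with positive real part and Jordan blocks on the imaginary axis;
   the symmetry l -> - l of the spectrum of J L rules out negative real parts. *)
Require Import Defs.
From HB Require Import structures.
From mathcomp Require Import all_boot all_order all_algebra.
From mathcomp Require Import perm sesquilinear.
From mathcomp Require Import all_classical all_reals all_analysis.
From mathcomp Require Import complex.
From mathcomp Require Import ring lra.

Set Implicit Arguments.
Unset Strict Implicit.
Unset Printing Implicit Defensive.

Import Order.TTheory GRing.Theory Num.Theory.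
Import numFieldNormedType.Exports.

Local Open Scope ring_scope.

(** * Skew, symmetric and positive definite matrices *)

Lemma skewmxE (R : fieldType) (m : nat) (J : 'M[R]_m) :
  (J \is skewmx) = (J^T == - J).
Proof.
rewrite is_hermitianmxE expr1 map_mx_id // scaleN1r.
by rewrite -[LHS]eqr_opp opprK eq_sym.
Qed.

Lemma symmetricmxE (R : fieldType) (m : nat) (L : 'M[R]_m) :
  (L \is symmetricmx) = (L^T == L).
Proof. by rewrite is_hermitianmxE expr0 map_mx_id // scale1r eq_sym. Qed.

Lemma tr_symplectic_unit (R : realType) (n : nat) :
  (symplectic_unit R n)^T = - symplectic_unit R n.
Proof.
by rewrite /symplectic_unit tr_block_mx opp_block_mx !linearN /= !trmx0 trmx1
  !oppr0 opprK.
Qed.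

Lemma symplectic_unit_sqr (R : realType) (n : nat) :
  symplectic_unit R n *m symplectic_unit R n = - 1%:M.
Proof.
rewrite /symplectic_unit mulmx_block !mul0mx !mulmx0 !mulmx1 mulmxN mulmx1.
by rewrite addr0 !add0r addr0 scalar_mx_block opp_block_mx oppr0.
Qed.

Lemma symplectic_unit_unitmx (R : realType) (n : nat) :
  symplectic_unit R n \in unitmx.
Proof.
have /mulmx1_unit[] // : symplectic_unit R n *m - symplectic_unit R n = 1%:M.
by rewrite mulmxN symplectic_unit_sqr opprK.
Qed.

Lemma diag2E (R : realType) (n : nat) (b : 'rV[R]_n) :
  diag2 b = diag_mx (row_mx b b).
Proof. by rewrite diag_mx_row. Qed.

Lemma row_mxx_gt0 (R : realType) (n : nat) (b : 'rV[R]_n) :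
  (forall i, 0 < b 0 i) -> forall k, 0 < row_mx b b 0 k.
Proof. by move=> b0 k; rewrite mxE; case: fintype.split. Qed.

Lemma quad_diag (R : comPzRingType) (m : nat) (d : 'rV[R]_m) (y : 'cV[R]_m) :
  (y^T *m diag_mx d *m y) 0 0 = \sum_k d 0 k * y k 0 ^+ 2.
Proof.
rewrite mul_mx_diag mxE; apply: eq_bigr => k _.
by rewrite !mxE mulrAC mulrC expr2.
Qed.

Lemma SPD_congr (R : realType) (m : nat) (D P : 'M[R]_m) :
  P \in unitmx -> SPD D -> SPD (P^T *m D *m P).
Proof.
move=> uP [sD pD]; split.
  move: sD; rewrite !symmetricmxE => /eqP sD.
  by rewrite !trmx_mul trmxK sD mulmxA.
move=> x x0; rewrite !mulmxA -trmx_mul -(mulmxA _ P); apply: pD.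
by apply: contra_neq x0 => Px0; rewrite -(mulKmx uP x) Px0 mulmx0.
Qed.

Lemma SPD_diag (R : realType) (m : nat) (d : 'rV[R]_m) :
  (forall k, 0 < d 0 k) -> SPD (diag_mx d).
Proof.
move=> d0; split; first by rewrite symmetricmxE tr_diag_mx.
move=> x x0; rewrite quad_diag.
have /cV0Pn[k xk0] := x0.
rewrite (bigD1 k) //= ltr_pwDl ?(mulr_gt0 (d0 k)) ?exprn_even_gt0 //.
by apply: sumr_ge0 => i _; rewrite mulr_ge0 ?sqr_ge0 // ltW.
Qed.

Lemma SPD_unitmx (R : realType) (m : nat) (L : 'M[R]_m) :
  SPD L -> L \in unitmx.
Proof.
move=> [_ pL]; rewrite -unitmx_tr -row_free_unit -kermx_eq0; apply/rowV0P => v.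
move=> /sub_kermxP vL; apply/eqP; apply: contraT => v0.
have := pL v^T; rewrite trmx_eq0 => /(_ v0).
by rewrite trmxK -mulmxA -[L]trmxK -trmx_mul vL trmx0 mulmx0 mxE ltxx.
Qed.

(** In [J *m L] the factors [G^T] and [(invmx G)^T] cancel, which leaves [G J_{2n} L_0 G^{-1} = A];
    both [J] and [L] are congruence transforms, and these preserve skewness, symmetry and
    definiteness. *)
Lemma reduces_by_hamiltonian (R : realType) (n : nat) (A G : 'M[R]_(n + n))
    (b : 'rV[R]_n) : reduces_by A G b ->
  let J := G *m symplectic_unit R n *m G^T in
  let L := (invmx G)^T *m diag2 b *m invmx G in
  [/\ A = J *m L, SS J & SPD L].
Proof.
move=> [uG _ b0 AG] J L; split.
- rewrite /J /L !mulmxA -[_ *m G^T *m _]mulmxA -trmx_mul mulVmx // trmx1 mulmx1.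
  by rewrite -[_ *m diag2 b]mulmxA -AG !mulmxA mulmxV // mul1mx mulmxK.
- split; last by rewrite /J !unitmx_mul uG symplectic_unit_unitmx unitmx_tr.
  rewrite skewmxE /J !trmx_mul trmxK tr_symplectic_unit.
  by rewrite mulNmx mulmxN mulmxA.
- apply: SPD_congr; first by rewrite unitmx_inv.
  by rewrite diag2E; apply: SPD_diag; apply: row_mxx_gt0.
Qed.

(** * From purely imaginary spectrum to the normal form *)

Lemma mxrank_adds_row (F : fieldType) (p m : nat) (v : 'rV[F]_m)
    (W : 'M[F]_(p, m)) :
  ~~ (v <= W)%MS -> \rank (v + W)%MS = (\rank W).+1.
Proof.
move=> vW; apply/eqP; rewrite eqn_leq; apply/andP; split.
  apply: leq_trans (mxrank_adds_leqif v W) _.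
  by rewrite -[leqRHS]add1n leq_add2r rank_leq_row.
rewrite (ltn_leqif (mxrank_leqif_sup (addsmxSr v W))).
by apply: contra vW; apply: submx_trans; apply: addsmxSl.
Qed.

Lemma sort_row (R : realDomainType) (n : nat) (b : 'rV[R]_n) :
  exists s : 'S_n, forall i j : 'I_n, (i <= j)%N -> b 0 (s j) <= b 0 (s i).
Proof.
pose t := [tuple b 0 i | i < n].
have /tuple_permP[s ts] : perm_eq (sort >=%R t) t by rewrite perm_sort.
exists s => i j ij.
have st : sorted >=%R (sort >=%R t).
  by apply: sort_sorted => x y; exact: le_total.
have tE (k : 'I_n) : nth 0 (sort >=%R t) k = b 0 (s k).
  by rewrite ts -tnth_nth !tnth_mktuple.
rewrite -!tE; apply: (sorted_leq_nth _ _ 0 st) => //.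
- by move=> x y z /= yx zy; exact: le_trans zy yx.
- by move=> x; exact: le_refl.
- by rewrite inE size_sort size_tuple.
- by rewrite inE size_sort size_tuple.
Qed.

Lemma mulmx_complexifyE (R : realType) (m : nat) (A : 'M[R]_m)
    (v : 'rV[R[i]]_m) :
  let x := map_mx (@complex.Re R) v in
  let y := map_mx (@complex.Im R) v in
  map_mx (@complex.Re R) (v *m complexify A) = x *m A /\
  map_mx (@complex.Im R) (v *m complexify A) = y *m A.
Proof.
split; apply/rowP => k; rewrite !mxE raddf_sum; apply: eq_bigr => j _;
  rewrite !mxE; case: (v 0 j) => a c /=; ring.
Qed.

(** If every complex eigenspace lay in the complexification of [W], so would their sum, the whole
    space; but extending scalars does not change the rank of [W]. The plane comes from an
    eigenvector that escapes. *)
Lemma GH_plane (R : realType) (p m : nat) (A : 'M[R]_m) (W : 'M[R]_(p, m)) :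
  GH A -> (\rank W < m)%N ->
  exists (l : R) (x y : 'rV[R]_m),
    [/\ 0 < l, x *m A = - l *: y, y *m A = l *: x &
        ~~ ((x <= W) && (y <= W))%MS].
Proof.
move=> [/diagonalizablePeigen[rs _ rsE] eigA] rW.
have [l [v vl vW]] : exists l, exists2 v : 'rV[R[i]]_m,
    (v <= eigenspace (complexify A) l)%MS & ~~ (v <= map_mx (real_complex R) W)%MS.
  apply: contrapT => none.
  have : (1%:M <= map_mx (real_complex R) W)%MS.
    rewrite -rsE; elim: (rs) => [|l s IH]; first by rewrite big_nil sub0mx.
    rewrite big_cons addsmx_sub IH andbT; apply/row_subP => i.
    apply: contrapT => /negP niW; apply: none; exists l.
    by exists (row i (eigenspace (complexify A) l)) => //; exact: row_sub.
  move=> /mxrankS; rewrite mxrank1 mxrank_map => mW.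
  by move: (leq_trans rW mW); rewrite ltnn.
have v0 : v != 0 by apply: contraNneq vW => ->; exact: sub0mx.
have vA := eigenspaceP vl.
have [l0 rel0] : l != 0 /\ complex.Re l = 0.
  by apply: eigA; apply/eigenvalueP; exists v.
pose x := map_mx (@complex.Re R) v; pose y := map_mx (@complex.Im R) v.
pose c := complex.Im l.
have lE : l = Complex 0 c by rewrite -rel0 /c; case: (l).
have c0 : c != 0 by apply: contra_neq l0 => c0; rewrite lE c0.
have [xA yA] := mulmx_complexifyE A v.
have {}xA : x *m A = - c *: y.
  rewrite -xA vA lE; apply/rowP => k; rewrite !mxE.
  by case: (v 0 k) => a d /=; ring.
have {}yA : y *m A = c *: x.
  rewrite -yA vA lE; apply/rowP => k; rewrite !mxE.
  by case: (v 0 k) => a d /=; ring.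
(* Since [v = x + i y], having both parts in [W] would put [v] in its complexification. *)
have xyW : ~~ ((x <= W) && (y <= W))%MS.
  apply: contra vW => /andP[xW yW].
  have -> : v = map_mx (real_complex R) x + Complex 0 1 *: map_mx (real_complex R) y.
    apply/rowP => k; rewrite !mxE; case: (v 0 k) => a d /=.
    by apply/eqP; rewrite eq_complex /=; apply/andP; split; apply/eqP; ring.
  by rewrite addmx_sub ?scalemx_sub ?map_submx.
(* Passing to the conjugate eigenvector, that is from [y] to [- y], changes the sign of the
   frequency. *)
have [cp|cn|c00] := ltgtP 0 c; last by rewrite -c00 eqxx in c0.
- by exists c, x, y.
- exists (- c), x, (- y); split; rewrite ?oppr_gt0 //.
  + by rewrite xA opprK scalerN scaleNr.
  + by rewrite mulNmx yA scaleNr.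
  + by rewrite eqmx_opp.
Qed.

(** Induction on the number of planes: the span of those already found is invariant under [A], which
    upgrades the conclusion of [GH_plane], that [x] and [y] are not both in [W], to a rank increase
    of two. *)
Lemma GH_frame (R : realType) (m p : nat) (A : 'M[R]_m) :
  GH A -> (p + p <= m)%N ->
  exists (b : 'rV[R]_p) (X Y : 'M[R]_(p, m)),
    [/\ forall i, 0 < b 0 i, forall i, row i X *m A = - b 0 i *: row i Y,
        forall i, row i Y *m A = b 0 i *: row i X &
        \rank (X + Y)%MS = (p + p)%N].
Proof.
move=> ghA; elim: p => [_|p IH pm].
  exists 0, 0, 0; split; try by case.
  by rewrite adds0mx mxrank0.
have ppm : (p + p < m)%N by apply: leq_trans pm; rewrite addSn addnS.
have [b [X [Y [b0 XA YA rXY]]]] := IH (ltnW ppm).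
pose W := (X + Y)%MS.
have stW (q : nat) (w : 'M[R]_(q, m)) : (w <= W)%MS -> (w *m A <= W)%MS.
  move=> wW; apply: submx_trans (submxMr A wW) _.
  rewrite /W addsmxMr addsmx_sub; apply/andP; split; apply/row_subP => i.
    rewrite row_mul XA; apply: scalemx_sub.
    by apply: submx_trans (row_sub i Y) (addsmxSr _ _).
  rewrite row_mul YA; apply: scalemx_sub.
  by apply: submx_trans (row_sub i X) (addsmxSl _ _).
have [] := @GH_plane R _ m A W ghA; first by rewrite rXY.
move=> l [x [y [l0 xA yA xyW]]].
(* If [x] were in [W], then by invariance so would [x A = - l y], hence [y]. *)
have xW : ~~ (x <= W)%MS.
  apply: contra xyW => xW; rewrite xW /=.
  have := stW _ _ xW; rewrite xA => /(scalemx_sub (- l)^-1).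
  by rewrite scalerA mulVf ?scale1r // oppr_eq0 gt_eqF.
(* Write [y = u x + s] with [s] in [W] and apply [A]: [l x = - u l y + s A]. Substituting [y] again
   gives [l (1 + u^2) x = s A - u l s], which lies in [W], and the coefficient on the left is
   positive. *)
have yW : ~~ (y <= x + W)%MS.
  apply: contra xW => /sub_addsmxP[[u1 u2] /= yE].
  have {}yE : y = u1 0 0 *: x + u2 *m W.
    by rewrite {1}yE {1}[u1]mx11_scalar mul_scalar_mx.
  have u2W : (u2 *m W <= W)%MS by exact: submxMl.
  have u2WA := stW _ _ u2W.
  have : (l * (1 + u1 0 0 ^+ 2)) *: x =
      u2 *m W *m A + (- (u1 0 0 * l)) *: (u2 *m W).
    have := yA; rewrite {1}yE mulmxDl -scalemxAl xA [in X in X = _]yE => h.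
    apply/rowP => k; move/rowP/(_ k): h.
    move: (u2 *m W *m A) (u2 *m W) => s1 s2; rewrite !mxE; lra.
  move=> /(congr1 (fun M => (l * (1 + u1 0 0 ^+ 2))^-1 *: M)).
  rewrite scalerA mulVf ?scale1r => [->|].
    by rewrite scalemx_sub // addmx_sub // scalemx_sub.
  by rewrite mulf_neq0 ?gt_eqF // ltr_pwDl // sqr_ge0.
rewrite -[p.+1]add1n; exists (row_mx l%:M b), (col_mx x X), (col_mx y Y).
split.
- by move=> i; rewrite mxE; case: fintype.split => // j; rewrite ord1 mxE.
- move=> i; case: (@splitP 1 p i) => j ij.
    have -> : i = lshift p j by apply/val_inj.
    by rewrite !rowKu row_mxEl !row_id ord1 mxE mulr1n.
  have -> : i = rshift 1 j by apply/val_inj.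
  by rewrite !rowKd row_mxEr.
- move=> i; case: (@splitP 1 p i) => j ij.
    have -> : i = lshift p j by apply/val_inj.
    by rewrite !rowKu row_mxEl !row_id ord1 mxE mulr1n.
  have -> : i = rshift 1 j by apply/val_inj.
  by rewrite !rowKd row_mxEr.
- have -> : \rank (col_mx x X + col_mx y Y)%MS = \rank (y + (x + W))%MS.
    apply/eqmx_rank/eqmxP/eqmx_trans.
      apply: adds_eqmx; apply: eqmx_sym; exact: addsmxE.
    rewrite /W -!addsmxA (addsmxA X) (addsmxC X) -!addsmxA.
    by rewrite !addsmxA (addsmxC x y).
  by rewrite !mxrank_adds_row // rXY addSn addnS.
Qed.

Lemma GH_reduces (R : realType) (n : nat) (A : 'M[R]_(n + n)) :
  GH A -> exists (G : 'M[R]_(n + n)) (b : 'rV[R]_n), reduces_by A G b.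
Proof.
move=> /GH_frame /(_ (leqnn _))[b [X [Y [b0 XA YA rXY]]]].
have [s bs] := sort_row b.
(* With [Y] above [X], the relations [Y A = beta X] and [X A = - beta Y] read [P A = J_{2n} L_0 P],
   so [G] is the inverse of [P]. Both blocks are permuted by the same [s], so that the planes stay
   paired while the frequencies become decreasing. *)
pose P := col_mx (row_perm s Y) (row_perm s X).
have uP : P \in unitmx.
  rewrite -row_full_unit; apply/eqP; rewrite -[RHS]rXY.
  rewrite /P -addsmxE !row_permE.
  have e (Z : 'M[R]_(n, n + n)) : (perm_mx s *m Z :=: Z)%MS.
    by apply: eqmxMfull; rewrite row_full_unit unitmx_perm.
  by rewrite (adds_eqmx (e Y) (e X)) addsmxC.
exists (invmx P), (col_perm s b); split.
- by rewrite unitmx_inv.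
- by move=> i j ij; rewrite !mxE; apply: bs.
- by move=> i; rewrite mxE.
- rewrite invmxK; apply: (canLR (mulmxK uP)).
  rewrite /symplectic_unit /diag2 mulmx_block !mul0mx !mulmx0 !mul1mx mulNmx.
  rewrite mul1mx !addr0 !add0r /P mul_col_mx mul_block_col !mul0mx addr0 add0r.
  have rowE (Z : 'M[R]_(n, n + n)) i : row i (row_perm s Z) = row (s i) Z.
    by apply/rowP => k; rewrite !mxE.
  congr col_mx; apply/row_matrixP => i.
    rewrite mul_diag_mx row_mul rowE YA; apply/rowP => k.
    by rewrite !mxE.
  rewrite mulNmx mul_diag_mx row_mul rowE XA; apply/rowP => k.
  by rewrite !mxE mulNr.
Qed.

(** * A criterion for diagonalizability *)

(** It suffices that the minimal polynomial has simple roots. Were it [(X - z)^2 q], the hypothesis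
    would cancel one factor, and [(X - z) q] would already annihilate [B], in smaller degree. *)
Lemma diagonalizable_semisimple (F : closedFieldType) (m : nat) (B : 'M[F]_m) :
  (forall (l : F) (u : 'cV[F]_m), eigenvalue B l ->
     (B - l%:M) *m ((B - l%:M) *m u) = 0 -> (B - l%:M) *m u = 0) ->
  diagonalizable B.
Proof.
case: m B => [|m] B ss.
  by apply/diagonalizablePeigen; exists [::] => //; rewrite big_nil [1%:M]thinmx0.
apply/diagonalizableP.
have [rs pE] := closed_field_poly_normal (mxminpoly B).
rewrite (monicP (mxminpoly_monic B)) scale1r in pE.
exists rs; last by rewrite -pE.
apply: contraT => /(uniqPn 0)[i [j [ij jrs rij]]].
have irs : rs`_i \in rs by rewrite mem_nth // (ltn_trans ij).
set z := rs`_i in irs rij.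
have zE : eigenvalue B z.
  rewrite eigenvalue_root_min pE. by rewrite root_prod_XsubC.
have [s rss] : exists s, perm_eq rs (z :: z :: s).
  exists (rem z (rem z rs)).
  apply: (perm_trans (perm_to_rem irs)); rewrite perm_cons; apply: perm_to_rem.
  (* Cutting [rs] at [j] separates the two occurrences: index [i] falls in the first piece, and [j]
     heads the second. *)
  have cz : (1 < count_mem z rs)%N.
    rewrite -(cat_take_drop j rs) count_cat -addn1 leq_add //.
      rewrite -has_count has_pred1; apply/(nthP 0); exists i.
        by rewrite size_take jrs.
      by rewrite nth_take.
    rewrite -has_count has_pred1; apply/(nthP 0); exists 0%N.
      by rewrite size_drop subn_gt0.
    by rewrite nth_drop addn0 -rij.
  by rewrite -has_pred1 has_count count_rem irs /= eqxx subn_gt0.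
pose q := \prod_(x <- s) ('X - x%:P).
have {}pE : mxminpoly B = ('X - z%:P) * (('X - z%:P) * q).
  by rewrite pE (perm_big _ rss) /= !big_cons.
have hz : horner_mx B ('X - z%:P) = B - z%:M.
  by rewrite rmorphB /= horner_mx_X horner_mx_C.
have q0 : q != 0 by rewrite monic_neq0 // monic_prod_XsubC.
have xq0 : ('X - z%:P) * q != 0 by rewrite mulf_neq0 // polyXsubC_eq0.
have : horner_mx B (('X - z%:P) * q) = 0.
  have := mx_root_minpoly B; rewrite pE !rmorphM /= !hz => BBq.
  (* The hypothesis concerns column vectors, so it is applied to each column of [q(B)]. *)
  rewrite -mulmxE; apply/trmx_inj/row_matrixP => k; rewrite trmx0 row0 -tr_col.
  rewrite colE -mulmxA ss ?trmx0 // !mulmxA -[_ *m _ *m horner_mx _ _]mulmxA.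
  by rewrite !mulmxE BBq mul0mx.
move=> /mxminpoly_min /dvdp_leq => /(_ xq0).
by rewrite pE [X in (X <= _)%N]size_mul ?polyXsubC_eq0 // size_XsubC /= ltnn.
Qed.

(** * Matrix calculus and the conserved quadratic form *)

Lemma is_derive_mxP (R : realFieldType) (V : normedModType R) (m n : nat)
    (M : V -> 'M[R]_(m, n)) (D : 'M[R]_(m, n)) (t v : V) :
  is_derive t v M D <-> forall i j, is_derive t v (fun s => M s i j) (D i j).
Proof.
split=> [[dM <-] i j|dM].
  have /derivable_mxP/(_ i j) dMij := dM.
  by apply: DeriveDef => //; rewrite derive_mx // mxE.
have {}dM' : derivable M t v.
  by apply/derivable_mxP => i j; have [] := dM i j.
apply: DeriveDef => //; rewrite derive_mx //; apply/matrixP => i j.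
by rewrite mxE; have [] := dM i j.
Qed.

Lemma is_derive_mulmx (R : realFieldType) (V : normedModType R) (m n p : nat)
    (M : V -> 'M[R]_(m, n)) (N : V -> 'M[R]_(n, p)) (dM : 'M[R]_(m, n))
    (dN : 'M[R]_(n, p)) (t v : V) :
  is_derive t v M dM -> is_derive t v N dN ->
  is_derive t v (fun s => M s *m N s) (dM *m N t + M t *m dN).
Proof.
move=> /is_derive_mxP hM /is_derive_mxP hN; apply/is_derive_mxP => i j.
have -> : (fun s => (M s *m N s) i j) =
    \sum_k ((fun s => M s i k) * (fun s => N s k j)).
  by apply/funext => s; rewrite mxE fct_sumE.
apply: is_derive_eq; rewrite !mxE -big_split /=; apply: eq_bigr => k _.
by rewrite addrC [_ *: dM i k]mulrC.
Qed.

Lemma is_derive_trmx (R : realFieldType) (V : normedModType R) (m n : nat)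
    (M : V -> 'M[R]_(m, n)) (D : 'M[R]_(m, n)) (t v : V) :
  is_derive t v M D -> is_derive t v (fun s => (M s)^T) D^T.
Proof.
move=> /is_derive_mxP dM; apply/is_derive_mxP => i j; rewrite mxE.
under eq_fun do rewrite mxE; exact: dM.
Qed.

Lemma continuous_quad (R : realType) (m : nat) (L : 'M[R]_m) :
  continuous (fun x : 'cV[R]_m => (x^T *m L *m x) 0 0).
Proof.
have -> : (fun x : 'cV[R]_m => (x^T *m L *m x) 0 0) =
    (fun x => \sum_j (\sum_i x i 0 * L i j) * x j 0).
  apply/funext => x; rewrite mxE; apply: eq_bigr => j _; rewrite !mxE.
  by congr (_ * _); apply: eq_bigr => i _; rewrite !mxE.
apply: (continuous_big add_continuous) => j _ x.
apply: (@continuousM _ 'cV[R]_m); last exact: coord_continuous.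
apply: (continuous_big add_continuous) => i _ {}x.
apply: (@continuousM _ 'cV[R]_m); first exact: coord_continuous.
exact: cst_continuous.
Qed.

(** The derivative of [x^T L x] is [x^T (A^T L + L A) x = 0]. A solution has a prescribed derivative
    only at positive times, so time 0 is reached through continuity and the mean value theorem. *)
Lemma quad_conserved (R : realType) (m : nat) (A L : 'M[R]_m) (x0 : 'cV[R]_m)
    (x : R -> 'cV[R]_m) :
  A^T *m L + L *m A = 0 -> solves A x0 x ->
  forall t, 0 <= t -> ((x t)^T *m L *m x t) 0 0 = (x0^T *m L *m x0) 0 0.
Proof.
move=> AL [x00 cx dx] t; rewrite le_eqVlt => /predU1P[<-|t0]; first by rewrite x00.
pose V s := ((x s)^T *m L *m x s) 0 0.
have dV s : s \in `]0, t[%R -> is_derive s 1 V 0.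
  rewrite in_itv /= => /andP[s0 _]; have xs := dx s s0.
  have := is_derive_mulmx (is_derive_mulmx (is_derive_trmx xs)
    (is_derive_cst L s 1)) xs.
  move=> /is_derive_mxP/(_ 0 0) h; apply: is_derive_eq h _.
  rewrite mulmx0 addr0 trmx_mul -!mulmxA -mulmxDr (mulmxA L A).
  by rewrite (mulmxA A^T L) -mulmxDl AL mul0mx mulmx0 mxE.
have cV : {within `[0, t], continuous V}%classic.
  apply: (@continuous_subspaceW _ _ `[0, t]%classic `[0, +oo[%classic V).
    by move=> s /=; rewrite !in_itv /= => /andP[->].
    pose Q (y : 'cV[R]_m) := (y^T *m L *m y) 0 0.
  apply: (@within_continuous_comp _ _ _ _ x Q _ cx) => y _.
  exact: continuous_quad.
have [c _] := MVT t0 dV cV.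
by rewrite mul0r => /eqP; rewrite subr_eq0 => /eqP; rewrite /V x00.
Qed.

Lemma norm_cV_le (R : realType) (m : nat) (x : 'cV[R]_m) (M : R) :
  0 <= M -> (forall i, `|x i 0| <= M) -> `|x| <= M.
Proof.
move=> M0 xM; rewrite [leLHS]/Num.Def.normr /= mx_normrE bigmax_le // => -[i j] _.
by rewrite /= ord1.
Qed.

Lemma cV_le_norm (R : realType) (m : nat) (x : 'cV[R]_m) i : `|x i 0| <= `|x|.
Proof.
rewrite [leRHS]/Num.Def.normr /= mx_normrE.
exact: (le_bigmax _ (fun k : 'I_m * 'I_1 => `|x k.1 k.2|) (i, 0)).
Qed.

(** In the coordinates [y = P x] the form is a positive weighted sum of squares, so its value bounds
    each coordinate of [y]; then [x = P^{-1} y]. *)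
Lemma quad_bounded (R : realType) (m : nat) (P : 'M[R]_m) (d : 'rV[R]_m) (V : R) :
  P \in unitmx -> (forall k, 0 < d 0 k) ->
  exists M : R, forall x : 'cV[R]_m,
    (x^T *m (P^T *m diag_mx d *m P) *m x) 0 0 = V -> `|x| <= M.
Proof.
move=> uP d0.
(* From [y^2 <= s] follows [|y| <= 1 + s], a crude bound that avoids square roots. *)
pose c k := 1 + `|V| / d 0 k.
have c0 k : 0 <= c k by rewrite addr_ge0 // divr_ge0 // ltW.
exists (\sum_i \sum_k `|invmx P i k| * c k) => x xV.
pose y := P *m x.
have yV : \sum_k d 0 k * y k 0 ^+ 2 = V.
  by rewrite -xV -quad_diag /y trmx_mul !mulmxA.
have yc k : `|y k 0| <= c k.
  have dk := d0 k.
  have : d 0 k * y k 0 ^+ 2 <= `|V|.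
    apply: le_trans (ler_norm V); rewrite -yV (bigD1 k) //= lerDl.
    by apply: sumr_ge0 => i _; rewrite mulr_ge0 ?sqr_ge0 // ltW.
  rewrite mulrC -ler_pdivlMr // -real_normK ?num_real // /c => h.
  by apply: le_trans (lerD (lexx 1) h); nra.
have row0 i : 0 <= \sum_k `|invmx P i k| * c k.
  by apply: sumr_ge0 => k _; rewrite mulr_ge0.
apply: norm_cV_le => [|i]; first by apply: sumr_ge0.
(* The bound for row [i] is one of the nonnegative terms of the sum over all rows, so this sum
   serves every coordinate. *)
rewrite (bigD1 i) //= -[X in fun_of_matrix X](mulKmx uP) -/y.
apply: (@le_trans _ _ (\sum_k `|invmx P i k| * c k)).
  rewrite mxE (le_trans (ler_norm_sum _ _ _)) // ler_sum // => k _.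
  by rewrite normrM ler_wpM2l.
by rewrite lerDl sumr_ge0.
Qed.

Lemma reduces_by_stable (R : realType) (n : nat) (A G : 'M[R]_(n + n))
    (b : 'rV[R]_n) : reduces_by A G b -> marginally_stable A.
Proof.
move=> red x0 x sx.
have [AE [+ _] [+ _]] := reduces_by_hamiltonian red.
case: red => uG _ b0 _.
set J := G *m _ *m _ in AE *; set L := _ *m diag2 b *m _ in AE *.
rewrite skewmxE symmetricmxE => /eqP Jsk /eqP Lsym.
have AL : A^T *m L + L *m A = 0.
  by rewrite AE trmx_mul Jsk Lsym mulmxN mulNmx mulmxA addNr.
have uG' : invmx G \in unitmx by rewrite unitmx_inv.
have [M hM] := quad_bounded ((x0^T *m L *m x0) 0 0) uG' (row_mxx_gt0 b0).
exists M => t t0; apply: hM; rewrite -diag2E; exact: (quad_conserved AL sx t0).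
Qed.

(** * Explicit solutions and the consequences of stability *)

(* [t |-> Re (e^{(a + ib) t} (w + t v))], the solution attached to a Jordan
   chain [v = (A - (a + ib)) w], [(A - (a + ib)) v = 0]. *)
Definition jordan_solution (R : realType) (m : nat) (a b : R)
    (wr wi vr vi : 'cV[R]_m) (t : R) : 'cV[R]_m :=
  expR (a * t) *: (cos (b * t) *: (wr + t *: vr) - sin (b * t) *: (wi + t *: vi)).

Lemma jordan_solution_solves (R : realType) (m : nat) (A : 'M[R]_m) (a b : R)
    (wr wi vr vi : 'cV[R]_m) :
  A *m wr = a *: wr - b *: wi + vr -> A *m wi = b *: wr + a *: wi + vi ->
  A *m vr = a *: vr - b *: vi -> A *m vi = b *: vr + a *: vi ->
  solves A wr (jordan_solution a b wr wi vr vi).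
Proof.
move=> Awr Awi Avr Avi.
have dx (t : R) : is_derive t 1 (jordan_solution a b wr wi vr vi)
    (A *m jordan_solution a b wr wi vr vi t).
  apply/is_derive_mxP => i j; rewrite ord1 /jordan_solution -!scalemxAr mulmxBr.
  rewrite -!scalemxAr !mulmxDr -!scalemxAr Awr Awi Avr Avi.
  have lin (c : R) : is_derive t 1 (fun s => c * s) c.
    rewrite -[fun s => _]/(c *: @id R); apply: is_derive_eq.
    by rewrite /GRing.scale /= mulr1.
  have de : is_derive t 1 (fun s => expR (a * s)) (expR (a * t) * a).
    exact: (is_derive1_comp (is_derive_expR _) (lin a)).
  have dc : is_derive t 1 (fun s => cos (b * s)) (- sin (b * t) * b).
    exact: (is_derive1_comp (is_derive_cos _) (lin b)).
  have ds : is_derive t 1 (fun s => sin (b * s)) (cos (b * t) * b).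
    exact: (is_derive1_comp (is_derive_sin _) (lin b)).
  have -> : (fun s : R => (expR (a * s) *: (cos (b * s) *: (wr + s *: vr) -
        sin (b * s) *: (wi + s *: vi))) i 0) =
      ((fun s => expR (a * s)) * (
        (fun s => cos (b * s)) * (cst (wr i 0) + id * cst (vr i 0)) -
        (fun s => sin (b * s)) * (cst (wi i 0) + id * cst (vi i 0)))).
    by apply/funext => s; rewrite !mxE.
  apply: is_derive_eq; rewrite !mxE /GRing.scale /=.
  rewrite !fctE /=; ring.
split.
- by rewrite /jordan_solution !mulr0 expR0 cos0 sin0 !scale0r !scale1r subr0 addr0.
- apply: continuous_subspaceT => t; apply: differentiable_continuous.
  by apply/derivable1_diffP; have [] := dx t.
- by move=> t _.
Qed.

Lemma linear_bound_le0 (R : realFieldType) (c M : R) :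
  (forall t, 0 <= t -> c * t <= M) -> c <= 0.
Proof.
move=> cM; rewrite leNgt; apply/negP => c0.
have M0 : 0 <= M by have := cM 0 (lexx 0); rewrite mulr0.
have := cM ((M + 1) / c); rewrite mulrCA mulfV ?gt_eqF // mulr1.
by rewrite divr_ge0 ?(ltW c0) ?addr_ge0 // => /(_ isT); lra.
Qed.

(** The bounded quantity is the squared modulus of a coordinate of [e^{(a + ib) t} (w + t v)]: the
    real and imaginary parts are both solutions, and the sine and cosine disappear from the sum of
    their squares. *)
Lemma stable_jordan_bound (R : realType) (m : nat) (A : 'M[R]_m) (a b : R)
    (wr wi vr vi : 'cV[R]_m) : marginally_stable A ->
  A *m wr = a *: wr - b *: wi + vr -> A *m wi = b *: wr + a *: wi + vi ->
  A *m vr = a *: vr - b *: vi -> A *m vi = b *: vr + a *: vi ->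
  exists M : R, forall t k, 0 <= t ->
    expR (a * t) ^+ 2 * ((wr k 0 + t * vr k 0) ^+ 2 + (wi k 0 + t * vi k 0) ^+ 2)
      <= M.
Proof.
move=> stA Awr Awi Avr Avi.
have [M1 hM1] := stA _ _ (jordan_solution_solves Awr Awi Avr Avi).
(* Multiplying the chain by [- i] turns the imaginary part into a real part. *)
have sIm : solves A wi (jordan_solution a b wi (- wr) vi (- vr)).
  apply: jordan_solution_solves; rewrite ?mulmxN.
  - by rewrite Awi scalerN opprK addrC [b *: _ + _]addrC addrC.
  - by rewrite Awr !opprD opprK scalerN [- _ + b *: _]addrC.
  - by rewrite Avi scalerN opprK addrC.
  - by rewrite Avr opprD opprK scalerN addrC.
have [M2 hM2] := stA _ _ sIm.
exists (M1 ^+ 2 + M2 ^+ 2) => t k t0.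
have sqb (y : R) M (x : 'cV[R]_m) : y = x k 0 -> `|x| <= M -> y ^+ 2 <= M ^+ 2.
  move=> -> xM; have := le_trans (cV_le_norm x k) xM => h.
  by rewrite -[leLHS]real_normK ?num_real // lerXn2r // nnegrE (le_trans _ h).
have := sqb _ _ _ erefl (hM1 t t0); have := sqb _ _ _ erefl (hM2 t t0).
rewrite !mxE => h2 h1; have := lerD h1 h2; apply: le_trans.
rewrite le_eqVlt; apply/orP; left; apply/eqP.
have := cos2Dsin2 (b * t); set e := expR _; set c := cos _; set s := sin _.
set p := wr k 0 + _; set q := wi k 0 + _ => cs.
have -> : - wr k 0 + t * (- vr k 0) = - p by rewrite /p; ring.
transitivity (e ^+ 2 * ((c ^+ 2 + s ^+ 2) * (p ^+ 2 + q ^+ 2))); last ring.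
by rewrite cs mul1r.
Qed.

Lemma complexify_mulmxE (R : realType) (m : nat) (A : 'M[R]_m)
    (w : 'cV[R[i]]_m) :
  map_mx (@complex.Re R) (complexify A *m w) = A *m map_mx (@complex.Re R) w /\
  map_mx (@complex.Im R) (complexify A *m w) = A *m map_mx (@complex.Im R) w.
Proof.
split; apply/colP => k; rewrite !mxE raddf_sum; apply: eq_bigr => j _;
  rewrite !mxE; case: (w j 0) => a c /=; ring.
Qed.

Lemma stable_chain_bound (R : realType) (m : nat) (A : 'M[R]_m) (l : R[i])
    (w v : 'cV[R[i]]_m) : marginally_stable A ->
  complexify A *m w = l *: w + v -> complexify A *m v = l *: v ->
  exists M : R, forall t k, 0 <= t ->
    expR (complex.Re l * t) ^+ 2 *
      ((complex.Re (w k 0) + t * complex.Re (v k 0)) ^+ 2 +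
       (complex.Im (w k 0) + t * complex.Im (v k 0)) ^+ 2) <= M.
Proof.
move=> stA Aw Av.
have [Awr Awi] := complexify_mulmxE A w; have [Avr Avi] := complexify_mulmxE A v.
have [||||M hM] := @stable_jordan_bound R m A (complex.Re l) (complex.Im l)
  (map_mx (@complex.Re R) w) (map_mx (@complex.Im R) w)
  (map_mx (@complex.Re R) v) (map_mx (@complex.Im R) v) stA.
- rewrite -Awr Aw; apply/colP => k; rewrite !mxE.
  by case: (w k 0) (v k 0) l {Aw Av} => [? ?] [? ?] [? ?] /=; ring.
- rewrite -Awi Aw; apply/colP => k; rewrite !mxE.
  by case: (w k 0) (v k 0) l {Aw Av} => [? ?] [? ?] [? ?] /=; ring.
- rewrite -Avr Av; apply/colP => k; rewrite !mxE.
  by case: (v k 0) l {Aw Av} => [? ?] [? ?] /=; ring.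
- rewrite -Avi Av; apply/colP => k; rewrite !mxE.
  by case: (v k 0) l {Aw Av} => [? ?] [? ?] /=; ring.
- by exists M => t k t0; have := hM t k t0; rewrite !mxE.
Qed.

(** An eigenvector is a chain with [v = 0]. If [a > 0], then [e^{2 a t} >= a t], so the bound on
    [e^{2 a t} N] would make a linear function with positive slope bounded. *)
Lemma stable_eigenvalue_Re_le0 (R : realType) (m : nat) (A : 'M[R]_m) (l : R[i])
    (w : 'cV[R[i]]_m) : marginally_stable A -> w != 0 ->
  complexify A *m w = l *: w -> complex.Re l <= 0.
Proof.
move=> stA w0 Aw.
have [||M hM] := @stable_chain_bound R m A l w 0 stA.
- by rewrite addr0.
- by rewrite mulmx0 scaler0.
have /cV0Pn[k wk] := w0.
set a := complex.Re l in hM *; rewrite leNgt; apply/negP => a0.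
pose N := complex.Re (w k 0) ^+ 2 + complex.Im (w k 0) ^+ 2.
have N0 : 0 < N.
  rewrite lt_neqAle addr_ge0 ?sqr_ge0 // andbT eq_sym.
  rewrite paddr_eq0 ?sqr_ge0 // !sqrf_eq0.
  by move: wk; case: (w k 0) => x y; rewrite eq_complex.
have : a * N <= 0.
  apply: (@linear_bound_le0 _ _ M) => t t0.
  apply: le_trans (hM t k t0); rewrite !mxE !mulr0 !addr0 mulrAC -/N.
  rewrite ler_pM2r //; have at0 : 0 <= a * t by rewrite mulr_ge0 // ltW.
  have := expR_ge1Dx (a * t); nra.
by rewrite leNgt mulr_gt0.
Qed.

(** For [t >= 0] the exponential factor is at least 1, so the real and imaginary parts of [w + t v]
    are bounded affine functions of [t], and their slopes vanish. *)
Lemma stable_chain_trivial (R : realType) (m : nat) (A : 'M[R]_m) (l : R[i])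
    (w v : 'cV[R[i]]_m) : marginally_stable A -> 0 <= complex.Re l ->
  complexify A *m w = l *: w + v -> complexify A *m v = l *: v -> v = 0.
Proof.
move=> stA a0 Aw Av; have [M hM] := stable_chain_bound stA Aw Av.
have poly0 (p q : R) : (forall t, 0 <= t -> (p + t * q) ^+ 2 <= M) -> q = 0.
  move=> hpq; apply/eqP; rewrite -normr_le0.
  apply: (@linear_bound_le0 _ _ (M + 1 + `|p|)) => t t0.
  have := hpq t t0; rewrite -[X in X <= _ -> _]real_normK ?num_real // => h.
  have : `|p + t * q| <= M + 1 by nra.
  have : `|q| * t <= `|p + t * q| + `|p|.
    rewrite -[X in _ * X](ger0_norm t0) -normrM mulrC.
    by rewrite -{1}[t * q](addKr p) addrC (le_trans (ler_normB _ _)).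
  lra.
have dom t (x y : R) k : 0 <= t ->
    x ^+ 2 + y ^+ 2 = (complex.Re (w k 0) + t * complex.Re (v k 0)) ^+ 2 +
      (complex.Im (w k 0) + t * complex.Im (v k 0)) ^+ 2 -> x ^+ 2 <= M.
  move=> t0 xy; apply: le_trans (hM t k t0); rewrite -xy.
  have : 1 <= expR (complex.Re l * t).
    by apply: le_trans (expR_ge1Dx _); rewrite lerDl mulr_ge0.
  move: (expR _) => e e1; have := sqr_ge0 x; have := sqr_ge0 y.
  have : 1 <= e ^+ 2 by nra.
  nra.
apply/colP => k; rewrite mxE; apply/eqP; rewrite eq_complex /=.
apply/andP; split; apply/eqP.
- by apply: (poly0 (complex.Re (w k 0))) => t t0; apply: dom t0 erefl.
- by apply: (poly0 (complex.Im (w k 0))) => t t0; apply: dom t0 (addrC _ _).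
Qed.

(** * Stable generalized Hamiltonian matrices *)

(** [eigenvalue] speaks of row vectors, while solutions are columns; a square matrix and its
    transpose are singular together. *)
Lemma eigenvalue_cV (F : fieldType) (m : nat) (B : 'M[F]_m) (l : F) :
  eigenvalue B l -> exists2 u : 'cV[F]_m, u != 0 & B *m u = l *: u.
Proof.
rewrite /eigenvalue /eigenspace kermx_eq0 row_free_unit -unitmx_tr.
rewrite -row_free_unit -kermx_eq0 => /rowV0Pn[v /sub_kermxP vB v0].
exists v^T; first by rewrite trmx_eq0.
apply/eqP; rewrite -subr_eq0 -mul_scalar_mx -mulmxBl -[_ - _]trmxK -trmx_mul.
by rewrite vB trmx0.
Qed.

Lemma hamiltonian_stable_GH (R : realType) (m : nat) (A : 'M[R]_m) :
  generalized_hamiltonian A -> marginally_stable A -> GH A.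
Proof.
move=> [J [L [[skJ uJ] symL uL AE]]] stA.
move: skJ symL; rewrite skewmxE symmetricmxE => /eqP JT /eqP LT.
have uA : complexify A \in unitmx by rewrite map_unitmx AE unitmx_mul uJ.
have rel0 l : eigenvalue (complexify A) l -> complex.Re l = 0.
  move=> lA; apply/eqP; rewrite eq_le; apply/andP; split.
    have [u u0 Au] := eigenvalue_cV lA.
    exact: stable_eigenvalue_Re_le0 stA u0 Au.
  (* [A^T = - L J], so [J] carries eigenvectors of [A^T] for [l] to
     eigenvectors of [A] for [- l]. *)
  have /eigenvalueP[v vA v0] := lA.
  have := @stable_eigenvalue_Re_le0 R m A (- l) (complexify J *m v^T) stA.
  rewrite raddfN oppr_le0; apply.
    have uJC : complexify J \in unitmx by rewrite map_unitmx.
    apply: contra_neq v0 => Jv; apply: trmx_inj.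
    by rewrite trmx0 -(mulKmx uJC v^T) Jv mulmx0.
  have LJ : complexify (L *m J) = - (complexify A)^T.
    by rewrite /complexify map_trmx -map_mxN AE trmx_mul JT LT mulmxN opprK.
  rewrite mulmxA /complexify -map_mxM AE -mulmxA map_mxM -mulmxA.
  rewrite -/(complexify (L *m J)) LJ mulNmx -trmx_mul vA linearZ /=.
  by rewrite mulmxN -scalemxAr scaleNr.
split.
  apply: diagonalizable_semisimple => l u lA.
  (* The pair [u], [v] is a Jordan chain for an eigenvalue on the imaginary axis, so stability
     forces [v = 0]. *)
  set v := (_ - _) *m u => Bv.
  have Re0 : 0 <= complex.Re l by rewrite rel0.
  apply: (stable_chain_trivial (w := u) stA Re0).
    by rewrite /v mulmxBl mul_scalar_mx addrC subrK.
  by apply/eqP; rewrite -subr_eq0 -mul_scalar_mx -mulmxBl Bv.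
move=> l lA; split; last exact: rel0.
apply/eqP => l0; have /eigenvalueP[v] := lA; rewrite l0 scale0r => vA.
by rewrite -(mulmxK uA v) vA mul0mx eqxx.
Qed.

Unset Implicit Arguments.

Theorem theorem4p10 (R : realType) (n : nat) (A : 'M[R]_(n + n)) :
  [<-> GH A;
       generalized_hamiltonian A /\ marginally_stable A;
       exists (G : 'M[R]_(n + n)) (b : 'rV[R]_n), reduces_by A G b] /\
  (forall (G : 'M[R]_(n + n)) (b : 'rV[R]_n), reduces_by A G b ->
     let J := G *m symplectic_unit R n *m G^T in
     let L := (invmx G)^T *m diag2 b *m invmx G in
     [/\ A = J *m L, SS J & SPD L]).
Proof.
have cb (G : 'M[R]_(n + n)) b : reduces_by A G b ->
    generalized_hamiltonian A /\ marginally_stable A.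
  move=> red; split; last exact: reduces_by_stable red.
  have [AE ssJ spdL] := reduces_by_hamiltonian red.
  exists (G *m symplectic_unit R n *m G^T), ((invmx G)^T *m diag2 b *m invmx G).
  by split => //; [case: spdL | exact: SPD_unitmx].
split; last by move=> G b; exact: reduces_by_hamiltonian.
(* The lemmas prove (a) to (c), (c) to (b) and (b) to (a), so each implication of the cycle (a),
   (b), (c) is a composite of two of them. *)
tfae.
- by move=> /GH_reduces[G [b]]; exact: cb.
- by move=> [ghA stA]; apply: GH_reduces; exact: hamiltonian_stable_GH.
- by move=> [G [b /cb[ghA stA]]]; exact: hamiltonian_stable_GH.
Qed.
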